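(* Let $$\mu := \frac{1}{4}\,\delta_{-1} + \frac{1}{2}\,\delta_0 + \frac{1}{4}\,\delta_1 .$$ Then $\mu$ admits as convolution inverse in $\mathcal{D}'(\mathbb{R})$ (and also in the space of all measures on $\mathbb{Z}$) $$\nu := \sum_{n \in \mathbb{Z}} 2\,|n|\,(-1)^{|n|+1}\,\delta_n = \ldots + 6\,\delta_{-3} - 4\,\delta_{-2} + 2\,\delta_{-1} + 2\,\delta_1 - 4\,\delta_2 + 6\,\delta_3 + \ldots,$$ that is, $\mu \ast \nu = \delta_0$. Thus for any $f \in \mathbb{R}^{(\mathbb{Z})}$ (a real sequence on $\mathbb{Z}$ with compact support) there holds $(f \ast \mu) \ast \nu = f$.
   Context: For $x \in \mathbb{R}$, $\delta_x$ is the unit point mass (Dirac measure) at $x$. $\mathcal{D}'(\mathbb{R})$ is the space of distributions on $\mathbb{R}$; the convolution of two distributions is defined when one of them has compact support. A convolution inverse of a distribution $T$ is a distribution $V$ with $T \ast V = \delta_0$ (inverses need not be unique). A measure on $\mathbb{Z}$ is identified with an arbitrary (possibly unbounded) real sequence $(c_n)_{n \in \mathbb{Z}}$, namely $\sum_{n} c_n \delta_n$; convolution on $\mathbb{Z}$ is $(a \ast b)_n = \sum_{m \in \mathbb{Z}} a_{m}\, b_{n-m}$, defined when at least one of $a, b$ has finite support. $\mathbb{R}^{(\mathbb{Z})}$ denotes the set of all real sequences on $\mathbb{Z}$ with compact (i.e. finite) support, and such an $f$ is identified with $\sum_n f(n)\,\delta_n$. *)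

(* Defs.v *)
From HB Require Import structures.
From mathcomp Require Import all_boot all_order all_algebra.
From mathcomp Require Import all_classical all_reals all_analysis.
From mathcomp Require Import finmap zify.

Set Implicit Arguments.
Unset Strict Implicit.
Unset Printing Implicit Defensive.

Import Order.TTheory GRing.Theory Num.Theory.
Import numFieldNormedType.Exports.

Local Open Scope classical_set_scope.
Local Open Scope ring_scope.

Section TestFunctions.
Context {R : realType}.
Implicit Types f g : R -> R.

Definition smooth f := forall (n : nat) (x : R), derivable (derive1n n f) x 1.

Definition fsupport f : set R := closure [set x | f x != 0].

Definition is_testfun f := smooth f /\ compact (fsupport f).

Definition testfun_pred : {pred R -> R} := mem [set f | is_testfun f].

Lemma testfun_predP f : reflect (is_testfun f) (f \in testfun_pred).
Proof. by apply: (iffP idP) => [/set_mem|/mem_set]. Qed.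

Lemma derive1n_lin (a : R) f g n : smooth f -> smooth g ->
  derive1n n (a *: f + g) = a *: derive1n n f + derive1n n g.
Proof.
move=> sf sg; elim: n => [//|n IHn].
rewrite !derive1nS IHn; apply/funext => x.
rewrite derive1E deriveD; [|exact: derivableZ (sf n x)|exact: sg].
rewrite deriveZ; last exact: sf.
by rewrite !fctE !derive1E.
Qed.

Lemma smooth_lin (a : R) f g : smooth f -> smooth g -> smooth (a *: f + g).
Proof.
move=> sf sg n x; rewrite derive1n_lin//.
by apply: derivableD; [exact: derivableZ (sf n x)|exact: sg].
Qed.

Lemma testfun_submod_closed : submod_closed testfun_pred.
Proof.
have c0n n : derive1n n (0 : R -> R) = 0.
  elim: n => // n IHn; rewrite derive1nS IHn; apply/funext => x.
  by rewrite derive1E (derive_cst 0).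
split.
  apply/testfun_predP; split.
    by move=> n x; rewrite c0n; exact: (derivable_cst 0).
  rewrite /fsupport (_ : [set x | _] = set0) ?closure0; first exact: compact0.
  by rewrite -subset0 => x /=; rewrite eqxx.
move=> a f g /testfun_predP[sf cf] /testfun_predP[sg cg].
apply/testfun_predP; split; first exact: smooth_lin.
apply: (subclosed_compact _ (compactU cf cg)); first exact: closed_closure.
rewrite /fsupport -closureU; apply: closure_subset => x /=.
apply: contraPP => /not_orP[/negP/negPn/eqP fx0 /negP/negPn/eqP gx0].
by apply/negP/negPn; rewrite !fctE fx0 gx0 scaler0 addr0.
Qed.

HB.instance Definition _ :=
  GRing.isSubmodClosed.Build R (R -> R) testfun_pred testfun_submod_closed.

End TestFunctions.

Record testfun (R : realType) := TestFun {
  testfun_val :> R -> R;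
  testfun_valP : testfun_val \in @testfun_pred R }.

HB.instance Definition _ (R : realType) :=
  [isSub for @testfun_val R].
HB.instance Definition _ (R : realType) := [Choice of testfun R by <:].
HB.instance Definition _ (R : realType) :=
  [SubChoice_isSubLmodule of testfun R by <:].

Section Translation.
Context {R : realType}.
Implicit Types f : R -> R.

Lemma derive1n_shift f (y : R) n : smooth f ->
  derive1n n (fun x => f (x + y)) = (fun x => derive1n n f (x + y)).
Proof.
move=> sf; elim: n => // n IHn; rewrite !derive1nS IHn; apply/funext => x.
have dl : derivable (fun z : R => z + y) x 1.
  by apply: derivableD; [exact: derivable_id|exact: derivable_cst].
rewrite (@derive1_comp _ (fun z => z + y) (derive1n n f))//.
rewrite [X in _ * X]derive1E deriveD; [|exact: derivable_id|exact: derivable_cst].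
by rewrite derive_id derive_cst addr0 mulr1.
Qed.

Lemma shift_testfun (y : R) (phi : testfun R) :
  (fun x => phi (x + y)) \in @testfun_pred R.
Proof.
case: phi => f /= /testfun_predP[sf cf]; apply/testfun_predP; split.
  move=> n x; rewrite derive1n_shift//.
  apply/derivable1_diffP; apply: (@differentiable_comp _ _ _ _ (fun z => z + y)).
    by apply: differentiableD => //; exact: differentiable_cst.
  by apply/derivable1_diffP.
have cl : continuous (fun z : R => z - y).
  by move=> z; apply: cvgB; [exact: cvg_id|exact: cvg_cst].
have cl' : continuous (fun z : R => z + y).
  by move=> z; apply: cvgD; [exact: cvg_id|exact: cvg_cst].
apply: (subclosed_compact (@closed_closure _ _)).
  apply: (continuous_compact _ cf); exact: continuous_subspaceT cl.
move=> x xs; exists (x + y); last by rewrite addrK.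
move=> U /= Ux; have := xs _ (cl' _ _ Ux).
by case=> z [/= fz Uz]; exists (z + y).
Qed.

Definition translate (y : R) (phi : testfun R) : testfun R :=
  TestFun (shift_testfun y phi).

End Translation.

Section Distributions.
Context {R : realType}.

(* supremum norm; [sup] is meaningful on test functions and their derivatives,
   which are bounded *)
Definition supnorm (f : R -> R) : R := sup [set `|f x| | x in setT].

(* linearity, and continuity on D(R) expressed by the usual seminorm
   estimates on each compact set *)
Definition is_distribution (T : testfun R -> R) :=
  (forall (a : R) (phi psi : testfun R),
     T (a *: phi + psi) = a * T phi + T psi) /\
  forall K : set R, compact K -> exists (C : R) (N : nat),
    forall phi : testfun R, fsupport phi `<=` K ->
      `|T phi| <= C * \sum_(k < N.+1) supnorm (derive1n k phi).

Definition distribution_pred : {pred testfun R -> R} :=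
  mem [set T | is_distribution T].

Lemma distribution_predP (T : testfun R -> R) :
  reflect (is_distribution T) (T \in distribution_pred).
Proof. by apply: (iffP idP) => [/set_mem|/mem_set]. Qed.

Lemma supnorm_ge0 (f : R -> R) : 0 <= supnorm f.
Proof.
rewrite /supnorm; set A := [set _ | _ in _].
have [hs|/sup_out->//] := pselect (has_sup A).
apply: (@le_trans _ _ `|f 0|) => //.
by apply: ub_le_sup; [exact: hs.2|exists 0].
Qed.

Lemma distribution_submod_closed : submod_closed distribution_pred.
Proof.
split.
  apply/distribution_predP; split; first by move=> a phi psi; rewrite /= mulr0 addr0.
  by move=> K cK; exists 0, 0%N => phi _; rewrite mul0r /= normr0.
move=> a S T /distribution_predP[lS cS] /distribution_predP[lT cT].
apply/distribution_predP; split.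
  move=> b phi psi; rewrite !fctE lS lT !scalerDr /GRing.scale/=.
  by rewrite mulrDr addrACA mulrCA.
move=> K cK; have [C [N HS]] := cS K cK; have [D [M HT]] := cT K cK.
exists (`|a| * `|C| + `|D|), (maxn N M) => phi phiK.
have mono (n m : nat) : (n <= m)%N ->
    \sum_(k < n.+1) supnorm (derive1n k phi) <=
    \sum_(k < m.+1) supnorm (derive1n k phi).
  move=> nm; rewrite -!(big_mkord xpredT (fun k => supnorm (derive1n k phi))).
  rewrite (@big_cat_nat _ _ _ n.+1 0%N m.+1)//= lerDl.
  by apply: sumr_ge0 => i _; exact: supnorm_ge0.
have pos n : 0 <= \sum_(k < n.+1) supnorm (derive1n k phi).
  by apply: sumr_ge0 => i _; exact: supnorm_ge0.
rewrite !fctE mulrDl; apply: (le_trans (ler_normD _ _)); apply: lerD.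
  rewrite normrZ -mulrA ler_wpM2l//; apply: (le_trans (HS _ phiK)).
  by rewrite (le_trans (ler_wpM2r (pos N) (ler_norm C)))// ler_wpM2l// mono// leq_maxl.
apply: (le_trans (HT _ phiK)).
by rewrite (le_trans (ler_wpM2r (pos M) (ler_norm D)))// ler_wpM2l// mono// leq_maxr.
Qed.

HB.instance Definition _ := GRing.isSubmodClosed.Build R (testfun R -> R)
  distribution_pred distribution_submod_closed.

End Distributions.

Record distrib (R : realType) := Distrib {
  distrib_val :> testfun R -> R;
  distrib_valP : distrib_val \in @distribution_pred R }.

HB.instance Definition _ (R : realType) := [isSub for @distrib_val R].
HB.instance Definition _ (R : realType) := [Choice of distrib R by <:].
HB.instance Definition _ (R : realType) :=
  [SubChoice_isSubLmodule of distrib R by <:].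

Section PointMasses.
Context {R : realType}.
Implicit Types (phi psi : testfun R) (c : int -> R).

Lemma fsupport_out (f : R -> R) (x : R) : ~ fsupport f x -> f x = 0.
Proof. by apply: contra_notP => /eqP fx; exact: subset_closure. Qed.

Lemma fsupport_fset (K : set R) : compact K -> exists A : {fset int},
  forall phi, fsupport phi `<=` K -> forall n, n \notin A -> phi n%:~R = 0.
Proof.
move=> /compact_bounded[M [_ HM]].
have [N MN] : exists N : nat, M < N%:R.
  exists (Num.bound `|M|); apply: (le_lt_trans (ler_norm M)).
  by apply: archi_boundP.
exists [fset (k%:Z - N%:Z)%R | k in iota 0 (N + N).+1]%fset => phi phiK n nA.
apply: fsupport_out => /phiK /(HM _ MN) /=.
rewrite -intr_norm [N%:R]pmulrn ler_int => nN; move/negP: nA; apply.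
apply/imfsetP; exists (absz ((n : int) + N%:Z)); last by move: nN; clear; lia.
by rewrite inE mem_iota; move: nN; clear; lia.
Qed.

Lemma testfun_le_supnorm phi (x : R) : `|phi x| <= supnorm phi.
Proof.
have /testfun_predP[sphi cphi] := testfun_valP phi.
have cvphi : continuous (phi : R -> R).
  by move=> y; apply/differentiable_continuous/derivable1_diffP; exact: (sphi 0%N).
have := continuous_compact (continuous_subspaceT cvphi) cphi.
move=> /compact_bounded[M [_ HM]].
apply: ub_le_sup; last by exists x.
exists (`|M| + 1) => _ [y _ <-].
have [ys|/fsupport_out->] := pselect (fsupport phi y); last by rewrite normr0 addr_ge0.
apply: HM; first by rewrite (le_lt_trans (ler_norm M))// ltrDl.
by exists y.
Qed.

Lemma point_mass_subproof (x : R) :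
  (fun phi => phi x) \in @distribution_pred R.
Proof.
apply/distribution_predP; split => // K _; exists 1, 0%N => phi _.
by rewrite mul1r big_ord_recl big_ord0 addr0; exact: testfun_le_supnorm.
Qed.

Definition point_mass (x : R) : distrib R :=
  Distrib (point_mass_subproof x).

Lemma comb_subproof c :
  (fun phi => \sum_(n \in [set: int]) c n * point_mass n%:~R phi)
    \in @distribution_pred R.
Proof.
apply/distribution_predP.
have comb_fset phi (A : {fset int}) : (forall n, n \notin A -> phi n%:~R = 0) ->
    \sum_(n \in [set: int]) c n * point_mass n%:~R phi =
    \sum_(n <- A) c n * phi n%:~R.
  by move=> HA; rewrite (fsbigTE A)// => n /HA /= ->; rewrite mulr0.
split.
  move=> a phi psi.
  have /testfun_predP[_ cphi] := testfun_valP phi.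
  have /testfun_predP[_ cpsi] := testfun_valP psi.
  have [A HA] := fsupport_fset (compactU cphi cpsi).
  have Hphi n : n \notin A -> phi n%:~R = 0 by apply: HA; exact: subsetUl.
  have Hpsi n : n \notin A -> psi n%:~R = 0 by apply: HA; exact: subsetUr.
  rewrite !(comb_fset _ A)//; last first.
    by move=> n nA; rewrite /= !fctE Hphi// Hpsi// scaler0 addr0.
  rewrite mulr_sumr -big_split/=; apply: eq_bigr => n _.
  by rewrite !fctE mulrDr mulrCA.
move=> K /fsupport_fset[A HA]; exists (\sum_(n <- A) `|c n|), 0%N => phi phiK.
rewrite (comb_fset _ A); last exact: HA.
rewrite big_ord_recl big_ord0 addr0 mulr_suml.
apply: (le_trans (ler_norm_sum _ _ _)); apply: ler_sum => n _.
by rewrite normrM ler_wpM2l//; exact: testfun_le_supnorm.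
Qed.

(* sum_n c_n delta_n, for an arbitrary sequence c; against a test function only
   finitely many terms are nonzero, so that the finitely supported sum
   [\sum_(n \in _)] is not junk *)
Definition comb c : distrib R := Distrib (comb_subproof c).

End PointMasses.

Section Convolution.
Context {R : realType}.
Implicit Types S T U V : distrib R.

Definition dsupport T : set R := [set x | forall O : set R, nbhs x O ->
  exists2 phi : testfun R, fsupport phi `<=` O & T phi != 0].

Definition agree_near_dsupport T (g : R -> R) (psi : testfun R) :=
  exists O : set R,
    [/\ open O, dsupport T `<=` O & forall x, O x -> psi x = g x].

(* U = T * S, i.e. U(phi) = T_x(S_y(phi(x + y))), one of T, S having compact
   support.  The smooth function x |-> S_y(phi(x + y)) need not have compact
   support when S does not; T is then applied to any test function psi which
   coincides with it in a neighbourhood of the (compact) support of T, such a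
   psi being required to exist and the value not to depend on its choice. *)
Definition is_dconv T S U :=
  (compact (dsupport T) \/ compact (dsupport S)) /\
  forall phi : testfun R,
    let g := fun x => S (translate x phi) in
    (exists psi, agree_near_dsupport T g psi) /\
    (forall psi, agree_near_dsupport T g psi -> U phi = T psi).

Lemma is_dconv_unique T S U V : is_dconv T S U -> is_dconv T S V -> U = V.
Proof.
move=> [_ TSU] [_ TSV]; apply/val_inj/funext => phi.
have [[psi apsi] HU] := TSU phi; have [_ HV] := TSV phi.
by rewrite /= (HU _ apsi) (HV _ apsi).
Qed.

Definition is_dconv_inverse T V := is_dconv T V (point_mass 0).

End Convolution.

Section SequenceConvolution.
Context {R : realType}.
Implicit Types a b : int -> R.

Definition finite_supp a := finite_set [set n | a n != 0].

(* only meaningful when [finite_supp a \/ finite_supp b] *)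
Definition zconv a b : int -> R :=
  fun n => \sum_(m \in [set: int]) a m * b (n - m).

Definition zdelta (k : int) : int -> R := fun n => (n == k)%:R.

Definition is_zconv_inverse a b :=
  (finite_supp a \/ finite_supp b) /\ zconv a b = zdelta 0.

End SequenceConvolution.

Section MuNu.
Variable R : realType.

Definition mu : distrib R :=
  4^-1 *: point_mass (-1) + 2^-1 *: point_mass 0 + 4^-1 *: point_mass 1.

Definition mu_seq : int -> R :=
  4^-1 *: zdelta (-1) + 2^-1 *: zdelta 0 + 4^-1 *: zdelta 1.

Definition nu_seq : int -> R := fun n => 2 * `|n|%:R * (-1) ^+ `|n|.+1.

Definition nu : distrib R := comb nu_seq.

End MuNu.

(* Main.v *)
Require Import Defs.
From mathcomp Require Import all_boot all_order all_algebra.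
From mathcomp Require Import all_classical all_reals all_analysis.
From mathcomp Require Import finmap ring lra zify.

(* A finitely supported sum [sum_n a_n delta_n] convolves with any
   [sum_n c_n delta_n] as the sequences do, so everything reduces to the identity
   mu * nu = delta_0 for sequences, i.e. to the vanishing of
   nu(n - 1) + 2 nu(n) + nu(n + 1) for n <> 0, and to associativity.
   For distributions, smooth bump functions show that each integer [n] with
   [a_n <> 0] does belong to the support of [sum_n a_n delta_n], so that a test
   function prescribed near that support is prescribed at all these points. *)

Set Implicit Arguments.
Unset Strict Implicit.
Unset Printing Implicit Defensive.

Import Order.TTheory GRing.Theory Num.Theory.
Import numFieldNormedType.Exports.

Local Open Scope classical_set_scope.
Local Open Scope ring_scope.

(** * Smooth bump functions built from exp(-1/x) *)

Section FlatFunctions.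
Context {R : realType}.
Implicit Types (f g : R -> R) (p q r : {poly R}).

(** Coinduction principle: iterated derivatives never leave a class closed under differentiation, so
    each of them is again differentiable. *)
Lemma smooth_coind (P : (R -> R) -> Prop) :
  (forall f, P f -> exists2 g, P g & forall x : R, is_derive x 1 f (g x)) ->
  forall f, P f -> smooth f.
Proof.
move=> HP f Pf n x.
have Pn : P (derive1n n f).
  elim: n => // n IHn; rewrite derive1nS.
  have [g Pg dg] := HP _ IHn.
  suff -> : derive1 (derive1n n f) = g by [].
  by apply/funext => y; rewrite derive1E derive_val.
by have [g _ dg] := HP _ Pn; exact: ex_derive.
Qed.

(* Multiplying [p] by ['X] yields the difference quotient at [0]: hence the family
   is stable under differentiation and consists of smooth functions. *)
Definition flat p (x : R) : R :=
  if 0 < x then p.[x^-1] * expR (- x^-1) else 0.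

(** With t = 1/x, the exponential series gives t^(i+1) / (i+1)! <= exp t, so each t^i exp(-t) is at
    most (i+1)! x; the spare power of t supplies the factor x. *)
Lemma flat_linear_bound p : exists C, forall x, `|flat p x| <= C * `|x|.
Proof.
exists (\sum_(i < size p) `|p`_i| * i.+1`!%:R) => x.
rewrite /flat; case: ifPn => [x0|_]; last first.
  by rewrite normr0 mulr_ge0// sumr_ge0.
rewrite horner_coef normrM (ger0_norm (expR_ge0 _)) (ger0_norm (ltW x0)).
rewrite !mulr_suml.
apply: (@le_trans _ _ (\sum_(i < size p) `|p`_i| * x^-1 ^+ i * expR (- x^-1))).
  rewrite -mulr_suml ler_wpM2r ?expR_ge0//.
  apply: (le_trans (ler_norm_sum _ _ _)); apply: ler_sum => i _.
  by rewrite normrM (ger0_norm (exprn_ge0 _ _))// invr_ge0 ltW.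
apply: ler_sum => i _; rewrite -!mulrA ler_wpM2l// expRN ler_pdivrMr ?expR_gt0//.
have y0 : 0 <= x^-1 by rewrite invr_ge0 ltW.
have : x^-1 ^+ i.+1 / i.+1`!%:R <= expR x^-1.
  by apply: le_trans (expR_ge1Dxn i y0); rewrite lerDr.
rewrite ler_pdivrMr ?ltr0n ?fact_gt0// => h.
have -> : x^-1 ^+ i = x^-1 ^+ i.+1 * x by rewrite exprSr mulfVK ?gt_eqF.
by rewrite mulrAC [_ * expR _]mulrC ler_wpM2r// ltW.
Qed.

(** For x > 0 and t = 1/x, dt/dx = - t^2 turns the derivative of p(t) exp(-t) into t^2 (p - p')(t)
    exp(-t). Only the gluing at 0 needs an estimate. *)
Lemma is_derive_flat p (x : R) :
  is_derive x 1 (flat p) (flat ('X^2 * (p - p^`())) x).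
Proof.
have [x0|x0|->] := ltgtP x 0.
- rewrite [X in is_derive _ _ _ X](_ : _ = 0); last by rewrite /flat ltNge (ltW x0).
  apply: (near_eq_is_derive (f := cst 0)).
  near=> y; rewrite /flat ifN// -leNgt ltW//.
  by near: y; exact: lt_nbhsl.
- rewrite [X in is_derive _ _ _ X]/flat x0.
  apply: (near_eq_is_derive (f := (horner p \o GRing.inv) *
      (expR \o (fun y => - y^-1)))).
    near=> y; rewrite /flat ifT//.
    by near: y; exact: lt_nbhsr.
  have dV : is_derive x 1 (GRing.inv : R -> R) (- x ^- 2 *: 1).
    by apply: (is_deriveV (f := id)); rewrite gt_eqF.
  have dp : is_derive (x^-1) 1 (horner p) (p^`().[x^-1]).
    rewrite derivE derive1E; exact/derivableP/derivable_horner.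
  have := is_deriveM (is_derive1_comp dp dV)
    (is_derive1_comp (is_derive_expR _) (is_deriveN dV)).
  move/is_derive_eq; apply.
  rewrite !hornerE /GRing.scale/= exprVn; ring.
- rewrite [X in is_derive _ _ _ X]/flat ltxx; apply/is_derive1_caratheodory.
  have g0 : flat ('X * p) 0 = 0 by rewrite /flat ltxx.
  exists (flat ('X * p)); split => //.
    move=> z; rewrite /flat ltxx !subr0; case: ifPn => [z0|]; last by rewrite mul0r.
    by rewrite !hornerE; field; rewrite gt_eqF.
  (* The difference quotient is continuous at 0, by squeezing it under the linear bound. *)
  suff : flat ('X * p) y @[y --> (0 : R)] --> (0 : R) by rewrite -[X in _ --> X]g0.
  have [C HC] := flat_linear_bound ('X * p).
  apply/norm_cvg0P.
  apply: (@squeeze_cvgr _ _ _ _ (cst 0) (fun x => C * `|x|)).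
  + by near=> y; rewrite normr_ge0 HC.
  + exact: cvg_cst.
  + rewrite -[X in _ --> X](mulr0 C) -[X in C * X](@normr0 R R).
    by apply: cvgM; [exact: cvg_cst|apply: cvg_norm; exact: cvg_id].
Unshelve. all: by end_near. Qed.

(** The product and chain rules send a generator to a sum of two generators; closing under addition
    makes the class stable under differentiation. *)
Inductive flat_comp r : (R -> R) -> Prop :=
| FlatComp p q : flat_comp r (fun x => q.[x] * flat p r.[x])
| FlatCompD f g : flat_comp r f -> flat_comp r g -> flat_comp r (f + g).

Lemma smooth_flat_comp r f : flat_comp r f -> smooth f.
Proof.
apply: (@smooth_coind (flat_comp r)) => {}f.
elim=> {f} [p q|f g _ [f' rf df] _ [g' rg dg]].
  exists ((fun x => q^`().[x] * flat p r.[x]) +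
          (fun x => (q * r^`()).[x] * flat ('X^2 * (p - p^`())) r.[x])).
    by apply: FlatCompD; exact: FlatComp.
  move=> x.
  have dh s : is_derive x 1 (horner s) (s^`().[x]).
    by rewrite derivE derive1E; exact/derivableP/derivable_horner.
  have := is_deriveM (dh q) (is_derive1_comp (is_derive_flat p r.[x]) (dh r)).
  by move/is_derive_eq; apply; rewrite !fctE !hornerE /GRing.scale/=; ring.
exists (f' + g'); first exact: FlatCompD.
by move=> x; exact: is_deriveD.
Qed.

Lemma bump_testfun (a e : R) : 0 < e -> exists phi : testfun R,
  [/\ 0 < phi a & fsupport phi `<=` [set x | `|x - a| <= e]].
Proof.
move=> e0.
(* [r] is positive exactly when |x - a| < e, so composing the flat function with it cuts off both
   ends at once. *)
pose r : {poly R} := (e ^+ 2)%:P - ('X - a%:P) ^+ 2.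
pose b x := flat 1 r.[x].
have rE x : r.[x] = e ^+ 2 - (x - a) ^+ 2 by rewrite !hornerE.
have bs : fsupport b `<=` [set x | `|x - a| <= e].
  have cl : closed [set x | `|x - a| <= e].
    have -> : [set x | `|x - a| <= e] = closed_ball_ Num.norm a e.
      by apply/seteqP; split=> x /=; rewrite distrC.
    exact: closed_closed_ball_.
  rewrite [X in _ `<=` X](closure_id _).1//; apply: closure_subset => x /=.
  rewrite /b /flat rE; case: ifPn => [|_]; last by rewrite eqxx.
  rewrite subr_gt0 -(real_normK (num_real (x - a))) ltr_pXn2r// ?nnegrE ?(ltW e0)//.
  by move=> /ltW.
have tb : b \in @testfun_pred R.
  apply/testfun_predP; split.
    have := @smooth_flat_comp r _ (FlatComp r 1 1).
    by congr smooth; apply/funext => x; rewrite hornerE mul1r.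
  apply: (subclosed_compact (@closed_closure _ _) _ bs).
  have -> : [set x | `|x - a| <= e] = `[a - e, a + e]%classic.
    by apply/seteqP; split=> x /=; rewrite in_itv/= ler_distl.
  exact: segment_compact.
exists (TestFun tb); split => //=.
by rewrite /b /flat rE subrr expr0n subr0 exprn_gt0// hornerE mul1r expR_gt0.
Qed.

End FlatFunctions.

(** * Finitely supported sums and convolution of sequences on the integers *)

Lemma fsumT_restrict (V : nmodType) (I : choiceType) (A : set I) (F : I -> V) :
  (forall i, ~ A i -> F i = 0) ->
  \sum_(i \in [set: I]) F i = \sum_(i \in A) F i.
Proof. by move=> F0; apply/esym/fsbig_widen => // i [_ /F0]. Qed.

Section SequenceConvolutionTheory.
Context {R : realType}.
Implicit Types a b c d : int -> R.

Lemma supp_out a n : ~ [set m | a m != 0] n -> a n = 0.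
Proof. by move=> /negP/negPn/eqP. Qed.

(** The support lies in the sumset of the two supports. *)
Lemma finite_supp_zconv a b :
  finite_supp a -> finite_supp b -> finite_supp (zconv a b).
Proof.
move=> fa fb; apply: (sub_finite_set _ (finite_image (fun mk => mk.1 + mk.2)
  (finite_setX fa fb))) => n /=.
rewrite /zconv => /(@fsbigN1 _ _ _ int int _ (fun n m => a m * b (n - m)))[m _].
by rewrite mulf_eq0 negb_or => /andP[am bm]; exists (m, n - m); rewrite //= subrKC.
Qed.

(* A product measure integrated against [(m, k) |-> d (k + m)]. *)
Lemma zconv_pairing a c d :
  finite_supp a -> finite_supp c \/ finite_supp d ->
  \sum_(n \in [set: int]) zconv a c n * d n =
  \sum_(m \in [set: int]) a m * \sum_(k \in [set: int]) c k * d (k + m).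
Proof.
move=> fa fcd; pose A := [set m | a m != 0].
(* One finite set of outer indices serves all [m] in the support of [a], so that both sums become
   finite and can be exchanged. *)
have [N fN HN] : exists2 N : set int, finite_set N &
    forall m n, A m -> ~ N n -> c (n - m) * d n = 0.
  case: fcd => [fc|fd].
    exists ((fun mk => mk.1 + mk.2) @` (A `*` [set k | c k != 0])).
      exact/finite_image/finite_setX.
    move=> m n Am nN; rewrite (_ : c _ = 0) ?mul0r//; apply: supp_out => cnm.
    by apply: nN; exists (m, n - m); rewrite //= subrKC.
  exists [set n | d n != 0] => // m n _ /supp_out ->; exact: mulr0.
have zconvE n : zconv a c n * d n = \sum_(m \in A) a m * (c (n - m) * d n).
  rewrite /zconv (fsumT_restrict (A := A)) => [|m /supp_out ->]; last exact: mul0r.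
  by rewrite mulr_fsuml; apply: eq_fsbigr => m _; rewrite mulrA.
rewrite (fsumT_restrict (A := N)) => [|n nN]; last first.
  by rewrite zconvE fsbig1// => m Am; rewrite HN ?mulr0.
rewrite [RHS](fsumT_restrict (A := A)) => [|m /supp_out ->]; last exact: mul0r.
under eq_fsbigr do rewrite zconvE.
rewrite exchange_fsbig//; apply: eq_fsbigr => m /set_mem Am.
rewrite -mulr_fsumr; congr (_ * _).
rewrite [RHS](@reindex_fsbigT _ _ _ int int (fun n => n - m)); last first.
  by exists (fun n => n + m) => n; rewrite ?addrK ?subrK.
rewrite [RHS](fsumT_restrict (A := N)) => [|n nN]; last by rewrite subrK HN.
by apply: eq_fsbigr => n _; rewrite subrK.
Qed.

Lemma zconvA a b c : finite_supp a -> finite_supp b ->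
  zconv (zconv a b) c = zconv a (zconv b c).
Proof.
move=> fa fb; apply/funext => n.
(* Associativity is the pairing with the reflected translate of [c]. *)
rewrite {1}/zconv (@zconv_pairing a b (fun m => c (n - m)))//; last by left.
apply: eq_fsbigr => m _; congr (_ * _); apply: eq_fsbigr => k _.
by rewrite opprD addrA addrAC.
Qed.

Lemma zconv_delta0 a : zconv a (zdelta 0) = a.
Proof.
apply/funext => n; rewrite /zconv (fsumT_restrict (A := [set n])) => [|m /eqP mn].
  by rewrite fsbig_set1 /zdelta subrr eqxx mulr1.
by rewrite /zdelta subr_eq0 eq_sym (negbTE mn) mulr0.
Qed.

End SequenceConvolutionTheory.

(** * Convolution of combinations of point masses as distributions *)

Section CombConvolution.
Context {R : realType}.
Implicit Types (a c : int -> R) (phi : testfun R).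

Lemma testfun_int_finite_supp phi : finite_supp (fun n => phi n%:~R).
Proof.
have /testfun_predP[_ cphi] := testfun_valP phi.
have [A HA] := fsupport_fset cphi.
apply: (sub_finite_set _ (finite_fset A)) => n /=; apply: contraNT => nA.
by apply/eqP/HA => //.
Qed.

(** This is the pairing formula with d(n) = phi(n); [c] may be arbitrary because a test function is
    nonzero at finitely many integers only. *)
Lemma comb_zconv a c phi : finite_supp a ->
  comb (zconv a c) phi =
  \sum_(m \in [set: int]) a m * comb c (translate m%:~R phi).
Proof.
move=> fa.
rewrite [LHS](@zconv_pairing _ a c (fun n => phi n%:~R))//; last first.
  by right; exact: testfun_int_finite_supp.
apply: eq_fsbigr => m _; congr (_ * _); apply: eq_fsbigr => k _.
by rewrite /= intrD.
Qed.

Lemma dsupport_comb a : finite_supp a ->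
  dsupport (comb a) = [set n%:~R | n in [set n | a n != 0]].
Proof.
move=> fa; apply/seteqP; split=> [x xa|_ [n an <-] O].
  apply: contrapT => xA.
  (* Off the finite set of atoms, a test function supported in this open complement is
     annihilated. *)
  have oA : open (~` [set (n%:~R : R) | n in [set n | a n != 0]]).
    apply: closed_openC; apply: compact_closed; first exact: norm_hausdorff.
    exact/finite_compact/finite_image.
  have [phi phiO] := xa _ (open_nbhs_nbhs (conj oA xA)).
  move/negP; apply; rewrite /= fsbig1// => n _.
  have [->|an] := eqVneq (a n) 0; first exact: mul0r.
  rewrite (@fsupport_out _ phi) ?mulr0// => /phiO; apply.
  by exists n.
move=> /nbhs_ballP[e /= e0 eO].
(* The bound e/2 keeps the bump inside the given ball; the bound 1/2 keeps it away from every other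
   integer. *)
pose r := Num.min (e / 2) 2^-1.
have r0 : 0 < r by rewrite lt_min divr_gt0//= invr_gt0.
have [phi [phin phis]] := bump_testfun (n%:~R) r0.
exists phi.
  move=> x /phis /= xn; apply: eO; rewrite /ball/= distrC.
  by rewrite (le_lt_trans xn)// gt_min ltr_pdivrMr// ltr_pMr// ltr1n.
rewrite /= (fsumT_restrict (A := [set n])) => [|m mn].
  by rewrite fsbig_set1 mulf_neq0// gt_eqF.
rewrite (@fsupport_out _ phi) ?mulr0// => /phis /=.
rewrite -intrB -intr_norm le_min => /andP[_]; apply/negP; rewrite -ltNge.
apply: (@lt_le_trans _ _ 1); first by rewrite invf_lt1// ltr1n.
by rewrite -[1]/(1%:~R) ler_int; move: mn; clear => /= mn; lia.
Qed.

Lemma compact_dsupport_comb a : finite_supp a -> compact (dsupport (comb a)).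
Proof.
by move=> fa; rewrite dsupport_comb//; exact/finite_compact/finite_image.
Qed.

Lemma testfun_sum (I : Type) (s : seq I) (F : I -> testfun R) (x : R) :
  (\sum_(i <- s) F i) x = \sum_(i <- s) F i x.
Proof. by elim: s => [|i s IHs]; rewrite ?big_nil// !big_cons -IHs. Qed.

(* [x |-> sum_k c_k phi (x + k)] is not compactly supported, but on a bounded
   set it agrees with one of its partial sums. *)
Lemma comb_translate_bounded c phi (B : R) : exists psi : testfun R,
  forall x, `|x| < B -> psi x = comb c (translate x phi).
Proof.
have /testfun_predP[_ /compact_bounded[L [_ HL]]] := testfun_valP phi.
pose L' := `|L| + 1.
have {}HL x : L' < `|x| -> phi x = 0.
  move=> Lx; apply: fsupport_out => sx.
  suff : `|x| <= L' by rewrite leNgt Lx.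
  by apply: HL sx; rewrite (le_lt_trans (ler_norm L))// ltrDl.
(* If |x| < B and |x + y| <= L', then |y| <= L' + B: the supports of all these translates lie in one
   segment, hence one [A] for all x. *)
have [A HA] := @fsupport_fset R _ (@segment_compact _ (- (L' + B)) (L' + B)).
exists (\sum_(m <- A) c m *: translate m%:~R phi) => x xB.
rewrite testfun_sum /= (fsbigTE A) => [|n nA].
  by apply: eq_bigr => m _; rewrite [in RHS]addrC.
rewrite [X in _ * X](HA (translate x phi) _ _ nA) ?mulr0//.
rewrite /fsupport [X in _ `<=` X](closure_id _).1; last exact: itv_closed.
apply: closure_subset => y /=; rewrite in_itv/= -ler_norml; apply: contraNT.
rewrite -ltNge => yB; apply/eqP/HL.
by have := lerB_normD y x; move: xB yB; lra.
Qed.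

(** [comb a] sees a test function only through its values at the atoms, all of which lie in the
    support; prescribing it near the support thus determines the pairing, which [comb_zconv]
    computes. *)
Lemma is_dconv_comb a c : finite_supp a ->
  is_dconv (comb a) (comb c) (comb (zconv a c)).
Proof.
move=> fa; have ca := compact_dsupport_comb fa; split; first by left.
move=> phi g; split.
  have [L [_ HL]] := compact_bounded ca.
  (* The support satisfies |x| <= |L| + 1, so the open ball of radius |L| + 2 is a neighbourhood of
     it. *)
  have [psi Hpsi] := comb_translate_bounded c phi (`|L| + 2).
  exists psi, [set x | `|x| < `|L| + 2]; split => //.
    have -> : [set x | `|x| < `|L| + 2] = ball (0 : R) (`|L| + 2).
      by apply/seteqP; split=> x; rewrite /ball/= sub0r normrN.
    exact: ball_open.
  move=> x ax; apply: (@le_lt_trans _ _ (`|L| + 1)); last by rewrite ltrD2l ltr1n.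
  by apply: HL ax; rewrite (le_lt_trans (ler_norm L))// ltrDl.
move=> psi [U [_ aU psiU]]; rewrite comb_zconv//; apply: eq_fsbigr => n _.
have [->|an] := eqVneq (a n) 0; first by rewrite !mul0r.
rewrite /= psiU//; apply: aU; rewrite dsupport_comb//; exists n => //.
Qed.

End CombConvolution.

(** * The sequences of mu and nu, and their convolution *)

Section MuNuTheory.
Variable R : realType.

Lemma mu_seq_out n : n \notin [:: -1; 0; 1] -> mu_seq R n = 0.
Proof.
rewrite !inE !negb_or => /and3P[/negbTE n1 /negbTE n2 /negbTE n3].
by rewrite /mu_seq !fctE /zdelta n1 n2 n3 !scaler0 !addr0.
Qed.

Lemma mu_seq_sum (F : int -> R) :
  \sum_(n \in [set: int]) mu_seq R n * F n =
  4^-1 * F (-1) + 2^-1 * F 0 + 4^-1 * F 1.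
Proof.
rewrite (fsumT_restrict (A := [set` [:: -1; 0; 1]])) => [|n /negP/mu_seq_out->].
  rewrite -fsbig_seq// !big_cons big_nil /mu_seq !fctE /zdelta /GRing.scale/=.
  by ring.
exact: mul0r.
Qed.

Lemma finite_supp_mu_seq : finite_supp (mu_seq R).
Proof.
apply: (sub_finite_set _ (finite_seq [:: -1; 0; 1])) => n /=.
by apply: contraNT => /mu_seq_out ->.
Qed.

Lemma mu_comb : mu R = comb (mu_seq R).
Proof.
apply/val_inj/funext => phi.
by rewrite /= (mu_seq_sum (fun n => phi n%:~R)).
Qed.

Lemma zconv_mu_nu : zconv (mu_seq R) (nu_seq R) = zdelta 0.
Proof.
apply/funext => n; rewrite /zconv (mu_seq_sum (fun m => nu_seq R (n - m))).
(* Reflection preserves [nu_seq] and swaps the two outer terms, which carry equal weights. *)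
wlog n0 : n / 0 <= n => [H|].
  have nuN m : nu_seq R (- m) = nu_seq R m by rewrite /nu_seq abszN.
  have [/H//|/ltW n0] := leP 0 n; rewrite -oppr_ge0 in n0.
  rewrite (_ : zdelta 0 n = zdelta 0 (- n)); last by rewrite /zdelta oppr_eq0.
  rewrite -H// -(nuN (n - -1)) -(nuN (n - 0)) -(nuN (n - 1)) !opprB !subr0 !sub0r.
  by rewrite opprK addrC [-1 - n]addrC [1 - n]addrC; ring.
(* At n = 0 the two neighbours give 2/4 + 2/4 = 1. At n = k + 1 the alternating signs leave a second
   difference of the linear sequence k, k + 1, k + 2, which vanishes. *)
case: n n0 => // -[|k] _; rewrite /zdelta/= opprK !subr0 /nu_seq.
  by rewrite /= add0n subn0 !mulr0; field.
have -> : absz (k.+1%:Z + 1) = k.+2 by lia.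
have -> : absz (k.+1%:Z - 1) = k by lia.
by rewrite absz_nat !exprS -!natr1; field.
Qed.

Lemma comb_delta0 : comb (zdelta 0) = point_mass 0 :> distrib R.
Proof.
apply/val_inj/funext => phi /=.
rewrite (fsumT_restrict (A := [set 0])) => [|n /eqP/negbTE n0].
  by rewrite fsbig_set1 /zdelta mul1r.
by rewrite /zdelta n0 mul0r.
Qed.

End MuNuTheory.

Theorem theorem2 (R : realType) :
  [/\ is_dconv_inverse (mu R) (nu R),
      is_zconv_inverse (mu_seq R) (nu_seq R),
      (forall f : int -> R, finite_supp f ->
         finite_supp (zconv f (mu_seq R)) /\
         zconv (zconv f (mu_seq R)) (nu_seq R) = f) &
      (forall f : int -> R, finite_supp f ->
         exists2 g : distrib R,
           is_dconv (comb f) (mu R) g & is_dconv g (nu R) (comb f))].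
Proof.
have fmu := finite_supp_mu_seq R.
have inv (f : int -> R) : finite_supp f ->
    zconv (zconv f (mu_seq R)) (nu_seq R) = f.
  by move=> ff; rewrite zconvA// zconv_mu_nu zconv_delta0.
split.
- rewrite /is_dconv_inverse mu_comb -comb_delta0 -zconv_mu_nu.
  exact: is_dconv_comb.
- by split; [left|exact: zconv_mu_nu].
- by move=> f ff; split; [exact: finite_supp_zconv|exact: inv].
(* f * mu is again a finite combination of point masses, so convolving it with nu falls under the
   same lemma. *)
- move=> f ff; exists (comb (zconv f (mu_seq R))).
    by rewrite mu_comb; exact: is_dconv_comb.
  rewrite -[X in is_dconv _ _ (comb X)](inv _ ff).
  exact/is_dconv_comb/finite_supp_zconv.
Qed.
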